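(* For each guarded recursive specification $E$ over siACP and each $X \in \mathrm{vars}(E)$, there exists a guarded recursive specification $E'$ over ACP such that $\langle X \mid E\rangle = \langle X \mid E'\rangle$ is derivable from the axioms of siACP$_{\mathrm{rec}}^+$ (in infinitary conditional equational logic).
   Context: ACP: fix a set $A$ of actions with $\delta \notin A$, $A_\delta = A \cup \{\delta\}$, and a commutative, associative $\gamma: A_\delta \times A_\delta \to A_\delta$ with $\gamma(\delta,a)=\delta$. Signature: constants $a$ ($a\in A$), $\delta$; binary $+$, $\cdot$, $\parallel$, $\lfloor\!\lfloor$ (left merge), $\mid$ (communication merge); unary $\partial_H$ ($H\subseteq A$). Axioms ($a,b$ range over constants from $A_\delta$): A1 $x+y=y+x$; A2 $(x+y)+z=x+(y+z)$; A3 $x+x=x$; A4 $(x+y)\cdot z = x\cdot z+y\cdot z$; A5 $(x\cdot y)\cdot z = x\cdot(y\cdot z)$; A6 $x+\delta=x$; A7 $\delta\cdot x=\delta$; D1 $\partial_H(a)=a$ if $a\notin H$; D2 $\partial_H(a)=\delta$ if $a\in H$; D3 $\partial_H(x+y)=\partial_H(x)+\partial_H(y)$; D4 $\partial_H(x\cdot y)=\partial_H(x)\cdot\partial_H(y)$; CM1 $x\parallel y = x\lfloor\!\lfloor y + y\lfloor\!\lfloor x + x\mid y$; CM2 $a\lfloor\!\lfloor x = a\cdot x$; CM3 $a\cdot x\lfloor\!\lfloor y = a\cdot(x\parallel y)$; CM4 $(x+y)\lfloor\!\lfloor z = x\lfloor\!\lfloor z + y\lfloor\!\lfloor z$; CM5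 $a\cdot x\mid b = \gamma(a,b)\cdot x$; CM6 $a\mid b\cdot x=\gamma(a,b)\cdot x$; CM7 $a\cdot x\mid b\cdot y = \gamma(a,b)\cdot(x\parallel y)$; CM8 $(x+y)\mid z = x\mid z+y\mid z$; CM9 $x\mid(y+z)=x\mid y+x\mid z$; CM10 $\delta\mid x=\delta$; CM11 $x\mid\delta=\delta$; CM12 $a\mid b=\gamma(a,b)$. siACP: $\mathbb{N}^+$ denotes the positive naturals. The set $\mathcal{H}$ of interleaving histories is the subset of $(\mathbb{N}^+\times\mathbb{N}^+)^*$ defined inductively by: the empty sequence is in $\mathcal{H}$; $\langle i,n\rangle\in\mathcal{H}$ if $i\le n$; if $h\frown\langle i,n\rangle\in\mathcal{H}$, $j\le n$ and $n-1\le m\le n+1$, then $h\frown\langle i,n\rangle\frown\langle j,m\rangle\in\mathcal{H}$. Given are a set $S$ of control states, for each $n\in\mathbb{N}^+$ functions $\mathrm{sched}_n:\mathcal{H}\times S\to\{1,\dots,n\}$ and $\mathrm{upd}_n:\mathcal{H}\times S\times\{1,\dots,n\}\times A\to S$, a set $D$ of data, and a function $\mathrm{cr}$ from $D$ to closed terms (see below); for each $d\in D$ there are actions $\mathrm{pcr}(d),\mathrm{rcr}(d)\in A$ with $\gamma(\mathrm{pcr}(d),a)=\delta$ and $\gamma(a,b)\ne\mathrm{pcr}(d)$ for all $a,b\in A$. The signature of siACP is that of ACP plus, for each $n\in\mathbb{N}^+$, $h\in\mathcal{H}$, $s\in S$, an $n$-ary operator $\|^n_{h,s}$, and for each $n,i\in\mathbb{N}^+$,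 $i\le n$, $h\in\mathcal{H}$, $s\in S$, an $n$-ary operator $\pi^n_{i,h,s}$. Its axioms are those of ACP plus (with $n,i\in\mathbb{N}^+$, $i\le n$, $h\in\mathcal{H}$, $s\in S$, $d\in D$, $a$ any action constant from $A$ not of the form $\mathrm{pcr}(d)$ or $\mathrm{rcr}(d)$): SI1 $\|^n_{h,s}(x_1,\dots,x_n)=\pi^n_{\mathrm{sched}_n(h,s),h,s}(x_1,\dots,x_n)$; SI2 $\pi^n_{i,h,s}(x_1,\dots,x_{i-1},\delta,x_{i+1},\dots,x_n)=\delta$; SI3 $\pi^1_{i,h,s}(a)=a$; SI4 $\pi^{n+1}_{i,h,s}(x_1,\dots,x_{i-1},a,x_{i+1},\dots,x_{n+1}) = a\cdot\|^n_{h\frown\langle i,n\rangle,\mathrm{upd}_{n+1}(h,s,i,a)}(x_1,\dots,x_{i-1},x_{i+1},\dots,x_{n+1})$; SI5 $\pi^n_{i,h,s}(x_1,\dots,x_{i-1},a\cdot x'_i,x_{i+1},\dots,x_n) = a\cdot\|^n_{h\frown\langle i,n\rangle,\mathrm{upd}_n(h,s,i,a)}(x_1,\dots,x_{i-1},x'_i,x_{i+1},\dots,x_n)$; SI6 $\pi^n_{i,h,s}(x_1,\dots,x_{i-1},\mathrm{pcr}(d),x_{i+1},\dots,x_n) = \mathrm{rcr}(d)\cdot\|^n_{h\frown\langle i,n\rangle,\mathrm{upd}_n(h,s,i,\mathrm{pcr}(d))}(x_1,\dots,x_{i-1},x_{i+1},\dots,x_n,\mathrm{cr}(d))$; SI7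 $\pi^n_{i,h,s}(x_1,\dots,x_{i-1},\mathrm{pcr}(d)\cdot x'_i,x_{i+1},\dots,x_n) = \mathrm{rcr}(d)\cdot\|^{n+1}_{h\frown\langle i,n+1\rangle,\mathrm{upd}_n(h,s,i,\mathrm{pcr}(d))}(x_1,\dots,x_{i-1},x'_i,x_{i+1},\dots,x_n,\mathrm{cr}(d))$; SI8 $\pi^n_{i,h,s}(x_1,\dots,x_{i-1},x'_i+x''_i,x_{i+1},\dots,x_n) = \pi^n_{i,h,s}(x_1,\dots,x'_i,\dots,x_n)+\pi^n_{i,h,s}(x_1,\dots,x''_i,\dots,x_n)$. Guarded recursion: for $T$ = ACP or siACP, an occurrence of a variable $X$ in a $T$ term $t$ is guarded if $t$ has a subterm $a\cdot t'$ with $a\in A$ and $t'$ containing this occurrence; a term is guarded if all its variable occurrences are guarded. A guarded recursive specification over $T$ is a finite or countably infinite set $E=\{X=t_X\mid X\in V\}$, $V$ a set of variables, where each $t_X$ is either a guarded $T$ term with no variables outside $V$, or a $T$ term rewritable to such a term using the axioms of $T$ in either direction and/or the equations of $E$ other than $X=t_X$ from left to right; $\mathrm{vars}(E)$ is the set of variables in $E$. $T$ with guarded recursion adds a constant $\langle X\mid E\rangle$ for each guarded recursive specification $E$ over $T$ and $X\in\mathrm{vars}(E)$, together with RDP: $\langle X\mid E\rangle=\langle t_X\mid E\rangle$ for $X=t_X\in E$ (where $\langle t\mid E\rangle$ is $t$ with each $Y\in\mathrm{vars}(E)$ replaced by $\langle Y\mid E\rangle$) and RSP: $E\Rightarrow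 X=\langle X\mid E\rangle$ for $X\in\mathrm{vars}(E)$. siACP$_{\mathrm{rec}}^+$ is siACP extended with guarded recursion in this way, where $\mathrm{cr}$ is a function from $D$ to the set of all closed terms over the signature of siACP extended with guarded recursion (i.e. created processes may be given by closed terms containing recursion constants). ACP with guarded recursion is denoted ACP$_{\mathrm{rec}}$. The same $A$ and $\gamma$ are used in all theories.
   Formalization: SI3–SI5 are also allowed for actions rcr(d) (only pcr(d) is excluded), and the axioms, sched and upd use operators indexed by all finite sequences of pairs, since SI4 leaves H; E and the terms cr(d) still use only histories in H. Without these changes the claim fails. *)

(* Defs.v *)
From mathcomp Require Import all_boot.
From mathcomp Require Import boolp classical_sets functions cardinality.

Set Implicit Arguments.
Unset Strict Implicit.
Unset Printing Implicit Defensive.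

Local Open Scope classical_set_scope.

(** * Interleaving histories

A pair [(i, n)] is the pair <i,n> of positive naturals. *)

Definition history := seq (nat * nat).

Inductive interleaving_history : history -> Prop :=
| ih_nil : interleaving_history [::]
| ih_one i n : 0 < i -> i <= n -> interleaving_history [:: (i, n)]
| ih_rcons h i n j m :
    interleaving_history (rcons h (i, n)) ->
    0 < j -> j <= n -> 0 < m -> n.-1 <= m -> m <= n.+1 ->
    interleaving_history (rcons (rcons h (i, n)) (j, m)).

(** * Terms

[A] is the set of actions, so [option A] is A_delta, [None] being delta; [S] is
the set of control states, [V] the set of variables and [K] a set of recursion
constants.  The strategic interleaving operators have positive arities, so
[inter] and [posi] with first argument [n] are n.+1-ary; their arguments, and
the processes in them, are numbered from 0 by ['I_n.+1], whereas histories
number processes from 1. *)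

Inductive binop := alt | seqc | par | lmerge | cmerge.

Inductive term (A S V K : Type) : Type :=
| var of V
| const of option A
| bin of binop & term A S V K & term A S V K
| encap of set A & term A S V K
| inter n of history & S & ('I_n.+1 -> term A S V K)
| posi n of 'I_n.+1 & history & S & ('I_n.+1 -> term A S V K)
| recc of K.

Arguments var {A S V K} _.
Arguments const {A S V K} _.
Arguments bin {A S V K} _ _ _.
Arguments encap {A S V K} _ _.
Arguments inter {A S V K n} _ _ _.
Arguments posi {A S V K n} _ _ _ _.
Arguments recc {A S V K} _.

Declare Scope proc_scope.
Delimit Scope proc_scope with P.
Bind Scope proc_scope with term.

Notation act a := (const (Some a)).
Notation delta := (const None).
Notation "t + u" := (bin alt t u) : proc_scope.
Notation "t * u" := (bin seqc t u) : proc_scope.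
Notation "t ∥ u" := (bin par t u) (at level 45, no associativity) : proc_scope.
Notation "t ⌊⌊ u" := (bin lmerge t u) (at level 45, no associativity) : proc_scope.
Notation "t ∣ u" := (bin cmerge t u) (at level 45, no associativity) : proc_scope.

(** A specification is the partial map sending [X] to t_X, so that its domain is
the set V of left-hand sides.  Right-hand sides contain no recursion constants,
whereas the terms of the theories with recursion contain constants
[recc (X, E)], i.e. <X|E>.  Syntactically [E] is arbitrary there; guardedness
depends on the axioms, and is imposed by [wf] below. *)

Definition pterm (A S V : Type) := term A S V void.
Definition spec (A S V : Type) := V -> option (pterm A S V).
Definition rterm (A S V : Type) := term A S V (V * spec A S V).

Definition vars A S V (E : spec A S V) : set V := [set X | E X <> None].

Fixpoint inst A S V (s : V -> rterm A S V) (t : pterm A S V) : rterm A S V :=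
  match t with
  | var x => s x
  | const c => const c
  | bin o t1 t2 => bin o (inst s t1) (inst s t2)
  | encap H t1 => encap H (inst s t1)
  | inter n h c ts => inter h c (fun j => inst s (ts j))
  | posi n i h c ts => posi i h c (fun j => inst s (ts j))
  | recc k => match k with end
  end.

Definition emb A S V (t : pterm A S V) : rterm A S V := inst var t.

(** The substitution turning t into <t|E>. *)
Definition recs A S V (E : spec A S V) (X : V) : rterm A S V :=
  if E X is Some _ then recc (X, E) else var X.

(** [occ x t g]: [x] has an occurrence in [t], which is guarded iff [g]. *)

Definition prefixing A S V K (o : binop) (t : term A S V K) : bool :=
  match o, t with seqc, act _ => true | _, _ => false end.

Inductive occ A S V K (x : V) : term A S V K -> bool -> Prop :=
| occ_var : occ x (var x) false
| occ_binl o t u g : occ x t g -> occ x (bin o t u) g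
| occ_binr o t u g : occ x u g -> occ x (bin o t u) (g || prefixing o t)
| occ_encap H t g : occ x t g -> occ x (encap H t) g
| occ_inter n h c (ts : 'I_n.+1 -> term A S V K) j g :
    occ x (ts j) g -> occ x (inter h c ts) g
| occ_posi n i h c (ts : 'I_n.+1 -> term A S V K) j g :
    occ x (ts j) g -> occ x (posi i h c ts) g.

Definition guarded A S V K (t : term A S V K) := forall x, ~ occ x t false.

Definition vars_in A S V K (U : set V) (t : term A S V K) :=
  forall x g, occ x t g -> U x.

Definition closed A S V K (t : term A S V K) := vars_in set0 t.

(** All strategic interleaving operators of [t] have their history in [Q]. *)
Fixpoint histories_in A S V K (Q : set history) (t : term A S V K) : Prop :=
  match t with
  | var _ | const _ | recc _ => True
  | bin _ t1 t2 => histories_in Q t1 /\ histories_in Q t2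
  | encap _ t1 => histories_in Q t1
  | inter n h _ ts | posi n _ h _ ts => Q h /\ forall j, histories_in Q (ts j)
  end.

Fixpoint constants_in A S V K (Q : set K) (t : term A S V K) : Prop :=
  match t with
  | var _ | const _ => True
  | bin _ t1 t2 => constants_in Q t1 /\ constants_in Q t2
  | encap _ t1 => constants_in Q t1
  | inter n _ _ ts | posi n _ _ _ ts => forall j, constants_in Q (ts j)
  | recc k => Q k
  end.

(** * Argument lists *)

Definition replace_arg T n (x : 'I_n -> T) (i : 'I_n) (t : T) : 'I_n -> T :=
  fun j => if j == i then t else x j.

Definition remove_arg T n (x : 'I_n.+1 -> T) (i : 'I_n.+1) : 'I_n -> T :=
  fun j => x (lift i j).

Definition append_arg T n (x : 'I_n -> T) (t : T) : 'I_n.+1 -> T :=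
  fun j => if unlift ord_max j is Some k then x k else t.

(** * Axioms

[sched n] and [upd n] are sched_(n+1) and upd_(n+1). *)

Record params (A D S V : Type) := Params {
  gamma : option A -> option A -> option A;
  pcr : D -> A;
  rcr : D -> A;
  sched : forall n : nat, history -> S -> 'I_n.+1;
  upd : forall n : nat, history -> S -> 'I_n.+1 -> A -> S;
  cr : D -> rterm A S V
}.

Inductive theory := ACP | siACP.

Section Theories.

Variables (A D S V : Type) (P : params A D S V).

Notation pterm := (pterm A S V).
Notation rterm := (rterm A S V).
Notation spec := (spec A S V).

Local Open Scope proc_scope.

Implicit Types (a b : option A) (x y z : rterm).

Definition mem_delta (H : set A) a : Prop := if a is Some e then H e else False.

Inductive acp_axiom : rterm -> rterm -> Prop :=
| A1 x y : acp_axiom (x + y) (y + x)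
| A2 x y z : acp_axiom ((x + y) + z) (x + (y + z))
| A3 x : acp_axiom (x + x) x
| A4 x y z : acp_axiom ((x + y) * z) (x * z + y * z)
| A5 x y z : acp_axiom ((x * y) * z) (x * (y * z))
| A6 x : acp_axiom (x + delta) x
| A7 x : acp_axiom (delta * x) delta
| D1 H a : ~ mem_delta H a -> acp_axiom (encap H (const a)) (const a)
| D2 H a : mem_delta H a -> acp_axiom (encap H (const a)) delta
| D3 H x y : acp_axiom (encap H (x + y)) (encap H x + encap H y)
| D4 H x y : acp_axiom (encap H (x * y)) (encap H x * encap H y)
| CM1 x y : acp_axiom (x ∥ y) ((x ⌊⌊ y + y ⌊⌊ x) + x ∣ y)
| CM2 a x : acp_axiom (const a ⌊⌊ x) (const a * x)
| CM3 a x y : acp_axiom ((const a * x) ⌊⌊ y) (const a * (x ∥ y))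
| CM4 x y z : acp_axiom ((x + y) ⌊⌊ z) (x ⌊⌊ z + y ⌊⌊ z)
| CM5 a b x : acp_axiom ((const a * x) ∣ const b) (const (gamma P a b) * x)
| CM6 a b x : acp_axiom (const a ∣ (const b * x)) (const (gamma P a b) * x)
| CM7 a b x y :
    acp_axiom ((const a * x) ∣ (const b * y)) (const (gamma P a b) * (x ∥ y))
| CM8 x y z : acp_axiom ((x + y) ∣ z) (x ∣ z + y ∣ z)
| CM9 x y z : acp_axiom (x ∣ (y + z)) (x ∣ y + x ∣ z)
| CM10 x : acp_axiom (delta ∣ x) delta
| CM11 x : acp_axiom (x ∣ delta) delta
| CM12 a b : acp_axiom (const a ∣ const b) (const (gamma P a b)).

(** The actions that SI3-SI5 pass on unchanged.  The [rcr d] are among them,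
although the usual side condition excludes them together with the [pcr d]: no
other axiom would apply to an [rcr d] in the position selected by π, and then
strategic interleaving could not be eliminated from ‖^1(rcr(d)), nor from
‖^1(‖^1(pcr(d))), where [SI6] brings the [rcr d] into that position. *)
Definition ordinary (e : A) : Prop := forall d, e <> pcr P d.

(** The histories range over all sequences, because SI4-SI7 lead out of the set
of interleaving histories: if the second of two processes terminates in the
first step, the new history is <2,1>, and the history of an operator may be
arbitrarily unrelated to its arity. *)
Inductive si_axiom : rterm -> rterm -> Prop :=
| SI1 n h s (x : 'I_n.+1 -> rterm) :
    si_axiom (inter h s x) (posi (sched P n h s) h s x)
| SI2 n (i : 'I_n.+1) h s (x : 'I_n.+1 -> rterm) :
    si_axiom (posi i h s (replace_arg x i delta)) delta
| SI3 (i : 'I_1) h s e : ordinary e ->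
    si_axiom (posi i h s (fun=> act e)) (act e)
| SI4 n (i : 'I_n.+2) h s (x : 'I_n.+2 -> rterm) e : ordinary e ->
    si_axiom (posi i h s (replace_arg x i (act e)))
      (act e * inter (rcons h (i.+1, n.+1)) (upd P h s i e) (remove_arg x i))
| SI5 n (i : 'I_n.+1) h s (x : 'I_n.+1 -> rterm) e y : ordinary e ->
    si_axiom (posi i h s (replace_arg x i (act e * y)))
      (act e * inter (rcons h (i.+1, n.+1)) (upd P h s i e) (replace_arg x i y))
| SI6 n (i : 'I_n.+1) h s (x : 'I_n.+1 -> rterm) d :
    si_axiom (posi i h s (replace_arg x i (act (pcr P d))))
      (act (rcr P d) *
       inter (rcons h (i.+1, n.+1)) (upd P h s i (pcr P d))
         (append_arg (remove_arg x i) (cr P d)))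
| SI7 n (i : 'I_n.+1) h s (x : 'I_n.+1 -> rterm) d y :
    si_axiom (posi i h s (replace_arg x i (act (pcr P d) * y)))
      (act (rcr P d) *
       inter (rcons h (i.+1, n.+2)) (upd P h s i (pcr P d))
         (append_arg (replace_arg x i y) (cr P d)))
| SI8 n (i : 'I_n.+1) h s (x : 'I_n.+1 -> rterm) y z :
    si_axiom (posi i h s (replace_arg x i (y + z)))
      (posi i h s (replace_arg x i y) + posi i h s (replace_arg x i z)).

Definition axiom (T : theory) t u : Prop :=
  match T with
  | ACP => acp_axiom t u
  | siACP => acp_axiom t u \/ si_axiom t u
  end.

(** * Guarded recursive specifications *)

(** Rewriting by the axioms of [T] in either direction and by the equations of
[E] other than the one for [X] from left to right.  Operators and recursion
constants foreign to the terms being rewritten may occur in between; no axiom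
distinguishes them from variables, so that they have no effect. *)
Inductive rewritable (T : theory) (E : spec) (X : V) : rterm -> rterm -> Prop :=
| rw_refl t : rewritable T E X t t
| rw_trans t u v :
    rewritable T E X t u -> rewritable T E X u v -> rewritable T E X t v
| rw_axiom t u : axiom T t u -> rewritable T E X t u
| rw_axiom_sym t u : axiom T t u -> rewritable T E X u t
| rw_equation Y t :
    Y <> X -> E Y = Some t -> rewritable T E X (var Y) (emb t)
| rw_bin o t t' u u' :
    rewritable T E X t t' -> rewritable T E X u u' ->
    rewritable T E X (bin o t u) (bin o t' u')
| rw_encap H t t' :
    rewritable T E X t t' -> rewritable T E X (encap H t) (encap H t')
| rw_inter n h s (ts ts' : 'I_n.+1 -> rterm) :
    (forall j, rewritable T E X (ts j) (ts' j)) ->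
    rewritable T E X (inter h s ts) (inter h s ts')
| rw_posi n i h s (ts ts' : 'I_n.+1 -> rterm) :
    (forall j, rewritable T E X (ts j) (ts' j)) ->
    rewritable T E X (posi i h s ts) (posi i h s ts').

Definition over (T : theory) : pterm -> Prop :=
  histories_in (if T is siACP then interleaving_history else set0).

(** Results of rewriting; see the remark on the histories in the axioms. *)
Definition over_ext (T : theory) : pterm -> Prop :=
  histories_in (if T is siACP then setT else set0).

(** A right-hand side that is itself guarded is covered by [rw_refl]. *)
Definition guarded_spec (T : theory) (E : spec) : Prop :=
  countable (vars E) /\
  forall X t, E X = Some t ->
    over T t /\
    exists t', [/\ rewritable T E X (emb t) (emb t'),
                   over_ext T t', guarded t' & vars_in (vars E) t'].

(** Terms all of whose recursion constants belong to the signature. *)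
Definition wf : rterm -> Prop :=
  constants_in [set k | guarded_spec siACP k.2 /\ vars k.2 k.1].

Definition created_processes_ok : Prop :=
  forall d, [/\ closed (cr P d), wf (cr P d)
              & histories_in interleaving_history (cr P d)].

(** * Derivability in infinitary conditional equational logic

The axioms above are closed under substitution.  RSP is a conditional equation
with one premise for each equation of [E]. *)
Inductive derivable : rterm -> rterm -> Prop :=
| d_refl t : wf t -> derivable t t
| d_sym t u : derivable t u -> derivable u t
| d_trans t u v : derivable t u -> derivable u v -> derivable t v
| d_axiom t u : wf t -> wf u -> axiom siACP t u -> derivable t u
| d_RDP E X t : guarded_spec siACP E -> E X = Some t ->
    derivable (recc (X, E)) (inst (recs E) t)
| d_RSP E (s : V -> rterm) X : guarded_spec siACP E -> vars E X ->
    (forall Y t, E Y = Some t -> derivable (s Y) (inst s t)) ->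
    derivable (s X) (recc (X, E))
| d_bin o t t' u u' : derivable t t' -> derivable u u' ->
    derivable (bin o t u) (bin o t' u')
| d_encap H t t' : derivable t t' -> derivable (encap H t) (encap H t')
| d_inter n h s (ts ts' : 'I_n.+1 -> rterm) :
    (forall j, derivable (ts j) (ts' j)) ->
    derivable (inter h s ts) (inter h s ts')
| d_posi n i h s (ts ts' : 'I_n.+1 -> rterm) :
    (forall j, derivable (ts j) (ts' j)) ->
    derivable (posi i h s ts) (posi i h s ts').

End Theories.

(* Main.v *)
(** Every closed term is derivably equal to a head normal form, a finite sum of
summands [a] and [a * p] with [p] closed: for [<X|E>] this uses RDP and the
guardedness of the right-hand side of [X], for an operator its axioms
distribute it over the sum and then push it below the first action.  The
iterated continuations of [<X|E>], addressed by finite sequences of summand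
numbers, therefore solve a linear, hence guarded, specification over ACP, and
RSP identifies [<X|E>] with the recursion constant of that specification. *)
Require Import Defs.
From Stdlib Require List.
From mathcomp Require Import all_boot.
From mathcomp Require Import boolp classical_sets functions cardinality.

Set Implicit Arguments.
Unset Strict Implicit.
Unset Printing Implicit Defensive.

Local Open Scope classical_set_scope.

(** * Argument lists under maps and predicates *)

Section ReplaceArg.

Variables (T U : Type) (n : nat).

Lemma replace_arg_id (x : 'I_n -> T) i : replace_arg x i (x i) = x.
Proof. by apply/funext => j; rewrite /replace_arg; case: eqP => [->|]. Qed.

Lemma replace_arg_map (f : T -> U) (x : 'I_n -> T) i t :
  (fun j => f (replace_arg x i t j)) = replace_arg (fun j => f (x j)) i (f t).
Proof. by apply/funext => j; rewrite /replace_arg; case: eqP. Qed.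

Lemma append_arg_map (f : T -> U) (x : 'I_n -> T) t :
  (fun j => f (append_arg x t j)) = append_arg (fun j => f (x j)) (f t).
Proof. by apply/funext => j; rewrite /append_arg; case: unlift. Qed.

Lemma replace_arg_all (Q : T -> Prop) (x : 'I_n -> T) i t :
  (forall j, Q (x j)) -> Q t -> forall j, Q (replace_arg x i t j).
Proof. by move=> Qx Qt j; rewrite /replace_arg; case: eqP. Qed.

Lemma append_arg_all (Q : T -> Prop) (x : 'I_n -> T) t :
  (forall j, Q (x j)) -> Q t -> forall j, Q (append_arg x t j).
Proof. by move=> Qx Qt j; rewrite /append_arg; case: unlift. Qed.

End ReplaceArg.

Section Derivations.

Variables (A D S V : Type) (P : params A D S V).
Hypothesis cr_ok : created_processes_ok P.

Notation pterm := (pterm A S V).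
Notation rterm := (rterm A S V).
Notation spec := (spec A S V).
Notation derivable := (derivable P).
Notation wf := (wf P).

Local Open Scope proc_scope.

Implicit Types (t u x y z p q : rterm) (e : A).

(** * Ground terms, and derivations obtained from rewriting *)

Definition declared (k : V * spec) : Prop :=
  guarded_spec P siACP k.2 /\ vars k.2 k.1.

(** Closedness and [wf] in one structural predicate: simplification splits it along the term,
    whereas [closed] speaks of occurrences. *)
Fixpoint ground t : Prop :=
  match t with
  | var _ => False
  | const _ => True
  | bin _ t1 t2 => ground t1 /\ ground t2
  | encap _ t1 => ground t1
  | inter n _ _ ts | posi n _ _ _ ts => forall j, ground (ts j)
  | recc k => declared k
  end.

Lemma ground_wf t : ground t -> wf t.
Proof.
rewrite /Defs.wf; elim: t => //= [o t IHt u IHu [? ?]|n h c ts IH H j|n i h c ts IH H j].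
- by split; auto.
- exact: IH.
- exact: IH.
Qed.

Lemma closed_wf_ground t : Defs.closed t -> wf t -> ground t.
Proof.
rewrite /Defs.closed /vars_in /Defs.wf.
elim: t => //= [x H _|o t IHt u IHu H [? ?]|H0 t IH H ?|n h c ts IH H w j|n i h c ts IH H w j].
- by case: (H x false); apply: occ_var.
- by split; [apply: IHt|apply: IHu] => // x g oc; apply: H;
    [apply: occ_binl|apply: occ_binr]; eassumption.
- by apply: IH => // x g oc; apply: H; apply: occ_encap; eassumption.
- by apply: IH => // x g oc; apply: H; apply: occ_inter; eassumption.
- by apply: IH => // x g oc; apply: H; apply: occ_posi; eassumption.
Qed.

Lemma ground_cr d : ground (cr P d).
Proof. by case: (cr_ok d) => cl w _; apply: closed_wf_ground. Qed.

Lemma ground_inst (U : set V) (s : V -> rterm) (t : pterm) :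
  vars_in U t -> (forall X, U X -> ground (s X)) -> ground (inst s t).
Proof.
move=> + Us; rewrite /vars_in.
elim: t => //= [x H|o t IHt u IHu H|H0 t IH H|n h c ts IH H j|n i h c ts IH H j].
- by apply/Us/(H x false); apply: occ_var.
- by split; [apply: IHt|apply: IHu] => // x g oc; apply: H;
    [apply: occ_binl|apply: occ_binr]; eassumption.
- by apply: IH => // x g oc; apply: H; apply: occ_encap; eassumption.
- by apply: IH => // x g oc; apply: H; apply: occ_inter; eassumption.
- by apply: IH => // x g oc; apply: H; apply: occ_posi; eassumption.
Qed.

(** Rewriting passes through terms with arbitrary recursion constants; sending
the undeclared ones to [delta] makes every step of it derivable. *)
Fixpoint close (s : V -> rterm) t : rterm :=
  match t with
  | var X => s X
  | const c => const c
  | bin o t1 t2 => bin o (close s t1) (close s t2)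
  | encap H t1 => encap H (close s t1)
  | inter n h c ts => inter h c (fun j => close s (ts j))
  | posi n i h c ts => posi i h c (fun j => close s (ts j))
  | recc k => if pselect (declared k) then recc k else delta
  end.

Lemma close_emb s (t : pterm) : close s (emb t) = inst s t.
Proof.
rewrite /emb; elim: t => //= [o t -> u -> //|H t -> //|n h c ts IH|n i h c ts IH].
- by congr inter; apply/funext => j.
- by congr posi; apply/funext => j.
Qed.

Lemma close_ground s t : ground t -> close s t = t.
Proof.
elim: t => //= [o t IHt u IHu [? ?]|H t IH ?|n h c ts IH H|n i h c ts IH H|k Hk].
- by rewrite IHt ?IHu.
- by rewrite IH.
- by congr inter; apply/funext => j; apply: IH.
- by congr posi; apply/funext => j; apply: IH.
- by case: pselect.
Qed.

Lemma close_wf s t : (forall X, wf (s X)) -> wf (close s t).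
Proof.
by rewrite /Defs.wf => ws; elim: t => //= k; case: pselect.
Qed.

(** The axioms are schematic, except that SI6 and SI7 mention the fixed terms [cr P d]; these are
    ground, so [close] leaves them alone. *)
Lemma close_axiom s t u : Defs.axiom P siACP t u ->
  Defs.axiom P siACP (close s t) (close s u).
Proof.
case=> [ax|ax]; [left|right].
  by case: ax => *; by constructor.
case: ax => /= [n h c x|n i h c x|i h c e oe|n i h c x e oe|n i h c x e y oe
    |n i h c x d|n i h c x d y|n i h c x y z].
- exact: SI1.
- by rewrite replace_arg_map; apply: SI2.
- exact: SI3.
- by rewrite replace_arg_map; exact: SI4.
- by rewrite !replace_arg_map; exact: SI5.
- by rewrite replace_arg_map append_arg_map (close_ground _ (ground_cr d)); exact: SI6.
- by rewrite replace_arg_map append_arg_map replace_arg_map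
    (close_ground _ (ground_cr d)); exact: SI7.
- by rewrite !replace_arg_map; exact: SI8.
Qed.

Lemma wf_recs (E : spec) X : guarded_spec P siACP E -> wf (recs E X).
Proof.
by rewrite /recs /Defs.wf => gE; case EX: (E X) => [t|] //=; split=> //; rewrite /vars /= EX.
Qed.

(** Under [recs E] a left-hand side [Y] becomes its recursion constant, so rewriting by an equation
    of [E] turns into an instance of RDP. *)
Lemma rewritable_derivable (E : spec) X t u : guarded_spec P siACP E ->
  rewritable P siACP E X t u -> derivable (close (recs E) t) (close (recs E) u).
Proof.
move=> gE; have w v : wf (close (recs E) v).
  by apply: close_wf => Y; apply: wf_recs.
elim=> {t u} /=.
- by move=> t; apply: d_refl.
- by move=> t u v _ H1 _; apply: d_trans.
- by move=> t u ax; apply: d_axiom => //; apply: close_axiom.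
- by move=> t u ax; apply: d_sym; apply: d_axiom => //; apply: close_axiom.
- by move=> Y t _ EY; rewrite close_emb {1}/recs EY; apply: d_RDP.
- by move=> o t t' u u' _ ? _ ?; apply: d_bin.
- by move=> H t t' _ ?; apply: d_encap.
- by move=> n h s ts ts' _ IH; apply: d_inter.
- by move=> n i h s ts ts' _ IH; apply: d_posi.
Qed.

Lemma recc_guarded (E : spec) X : declared (X, E) ->
  exists t : pterm, [/\ derivable (recc (X, E)) (inst (recs E) t), guarded t
              & vars_in (vars E) t].
Proof.
move=> [/= gE]; rewrite /vars /=; case EX: (E X) => [t|] // _.
case: (gE.2 _ _ EX) => _ [t' [rw _ gt vt]]; exists t'; split=> //.
apply: d_trans (d_RDP gE EX) _.
by rewrite -!close_emb; apply: rewritable_derivable rw.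
Qed.

(** * Head normal forms *)

Definition summand (K : Type) (m : A * option (term A S V K)) : term A S V K :=
  if m.2 is Some p then act m.1 * p else act m.1.

(** [K] is left open because sums serve both as head normal forms in [rterm] and, with [void], as
    right-hand sides of specifications. *)
Definition sum (K : Type) (l : seq (A * option (term A S V K))) : term A S V K :=
  foldr (fun m v => summand m + v) delta l.

Definition ground_summand (m : A * option rterm) : Prop :=
  if m.2 is Some p then ground p else True.

Definition has_hnf t : Prop :=
  exists2 l, (forall m, List.In m l -> ground_summand m) & derivable t (sum l).

Lemma ground_sum l : (forall m, List.In m l -> ground_summand m) -> ground (sum l).
Proof.
elim: l => //= -[e [p|]] l IH H /=; split; try apply: IH; auto.
by split=> //; apply: (H (e, Some p)); left.
Qed.

Lemma derivable_acp t u : ground t -> ground u -> acp_axiom P t u -> derivable t u.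
Proof. by move=> gt gu ax; apply: d_axiom; [exact: ground_wf..|left]. Qed.

Lemma derivable_si t u : ground t -> ground u -> si_axiom P t u -> derivable t u.
Proof. by move=> gt gu ax; apply: d_axiom; [exact: ground_wf..|right]. Qed.

Lemma derivable_ground_refl t : ground t -> derivable t t.
Proof. by move=> gt; apply/d_refl/ground_wf. Qed.

Lemma hnf_derivable t u : derivable t u -> has_hnf u -> has_hnf t.
Proof. by move=> tu [l gl ul]; exists l => //; apply: d_trans ul. Qed.

Lemma hnf_delta : has_hnf delta.
Proof. by exists [::] => //=; apply: d_refl. Qed.

Lemma hnf_summand m : ground_summand m -> has_hnf (summand m).
Proof.
move=> gm; exists [:: m] => /=; first by move=> ? [<-|].
have gs : ground (summand m) by case: m gm => e [p|].
by apply/d_sym/derivable_acp; [..|apply: A6].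
Qed.

Lemma hnf_act e : has_hnf (act e).
Proof. exact: (@hnf_summand (e, None)). Qed.

Lemma hnf_prefix e p : ground p -> has_hnf (act e * p).
Proof. exact: (@hnf_summand (e, Some p)). Qed.

(** Communication and encapsulation may turn the leading action into [delta]; A7 then collapses the
    whole product. *)
Lemma hnf_const_prefix a p : ground p -> has_hnf (const a * p).
Proof.
move=> gp; case: a => [e|]; first exact: hnf_prefix.
by apply: hnf_derivable hnf_delta; apply: derivable_acp => //; apply: A7.
Qed.

Lemma hnf_const a : has_hnf (const a).
Proof. by case: a => [e|]; [apply: hnf_act|apply: hnf_delta]. Qed.

Lemma hnf_alt t u : has_hnf t -> has_hnf u -> has_hnf (t + u).
Proof.
move=> [l gl tl] [k gk uk]; apply: hnf_derivable (d_bin alt tl uk) _.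
elim: l gl {t tl} => [|m l IH] gl /=.
  exists k => //; have g := ground_sum gk.
  apply: d_trans (derivable_acp _ _ (A1 _ _ _)) _ => //.
  by apply: derivable_acp => //; apply: A6.
have [|r gr lr] := IH; first by move=> ? ?; apply: gl; right.
have gm := gl m (or_introl erefl).
have gs : ground (summand m) by case: m gm {gl} => e [p|].
have gl' : ground (sum l) by apply: ground_sum => ? ?; apply: gl; right.
have gk' := ground_sum gk.
exists (m :: r) => /=; first by move=> ? [<-|/gr].
apply: d_trans (derivable_acp _ _ (A2 _ _ _ _)) _ => //.
by apply: d_bin lr; apply: derivable_ground_refl.
Qed.

(** A context that preserves [delta] and sums acts summand by summand, so each operator only has to
    be checked on the two shapes of summand. *)
Lemma hnf_linear (F : rterm -> rterm) :
  (forall t u, derivable t u -> derivable (F t) (F u)) ->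
  derivable (F delta) delta ->
  (forall t u, ground t -> ground u -> derivable (F (t + u)) (F t + F u)) ->
  (forall e, has_hnf (F (act e))) ->
  (forall e p, ground p -> has_hnf (F (act e * p))) ->
  forall t, has_hnf t -> has_hnf (F t).
Proof.
move=> Fcongr Fdelta Fadd Fact Fprefix t [l gl tl].
apply: hnf_derivable (Fcongr _ _ tl) _.
elim: l gl {t tl} => [|m l IH] gl /=; first exact: hnf_derivable hnf_delta.
have gm := gl m (or_introl erefl).
have gl' m' (h : List.In m' l) := gl m' (or_intror h).
apply: hnf_derivable (Fadd _ _ _ _) _; last 1 first.
- apply: hnf_alt (IH gl').
  by case: m gm {gl} => e [p|] gm; [apply: Fprefix|apply: Fact].
- by case: m gm {gl} => e [p|].
- exact: ground_sum.
Qed.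

(** * Closure of head normal forms under the operators *)

Lemma hnf_seqc t q : has_hnf t -> ground q -> has_hnf (t * q).
Proof.
move=> ht gq; apply: (hnf_linear (F := fun t => t * q)) ht => //.
- by move=> t1 t2 d; apply: d_bin d (derivable_ground_refl _).
- by apply: derivable_acp => //; apply: A7.
- by move=> t1 t2 g1 g2; apply: derivable_acp => //; apply: A4.
- by move=> e; apply: hnf_prefix.
- move=> e p gp; apply: hnf_derivable (hnf_prefix e (p := p * q) _) => //.
  by apply: derivable_acp => //; apply: A5.
Qed.

Lemma derivable_encap_const H a :
  exists b, derivable (encap H (const a)) (const b).
Proof.
case: (pselect (mem_delta H a)) => Ha.
  by exists None; apply: derivable_acp => //; apply: D2.
by exists a; apply: derivable_acp => //; apply: D1.
Qed.

Lemma hnf_encap H t : has_hnf t -> has_hnf (encap H t).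
Proof.
apply: (hnf_linear (F := encap H)).
- by move=> t1 t2; apply: d_encap.
(* D1 covers [delta], since [mem_delta H None] is [False]. *)
- by apply: derivable_acp => //; apply: D1.
- by move=> t1 t2 g1 g2; apply: derivable_acp => //; apply: D3.
- move=> e; have [b eb] := derivable_encap_const H (Some e).
  exact: hnf_derivable eb (hnf_const b).
- move=> e p gp; have [b eb] := derivable_encap_const H (Some e).
  apply: hnf_derivable (hnf_const_prefix b (p := encap H p) _) => //.
  apply: d_trans (derivable_acp _ _ (D4 _ _ _ _)) _ => //.
  by apply: d_bin eb _; apply: derivable_ground_refl.
Qed.

Lemma hnf_lmerge t q : has_hnf t -> ground q -> has_hnf (t ⌊⌊ q).
Proof.
move=> ht gq; apply: (hnf_linear (F := fun t => t ⌊⌊ q)) ht => //.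
- by move=> t1 t2 d; apply: d_bin d (derivable_ground_refl _).
- apply: d_trans (derivable_acp _ _ (CM2 _ _ _)) _ => //.
  by apply: derivable_acp => //; apply: A7.
- by move=> t1 t2 g1 g2; apply: derivable_acp => //; apply: CM4.
- move=> e; apply: hnf_derivable (hnf_prefix e gq) => //.
  by apply: derivable_acp => //; apply: CM2.
- move=> e p gp; apply: hnf_derivable (hnf_prefix e (p := p ∥ q) _) => //.
  by apply: derivable_acp => //; apply: CM3.
Qed.

(** Communication merge is linear in both arguments, so [hnf_linear] is nested; the four pairs of
    summand shapes fall to CM12, CM6, CM5 and CM7. *)
Lemma hnf_cmerge t u : ground t -> ground u ->
  has_hnf t -> has_hnf u -> has_hnf (t ∣ u).
Proof.
move=> gt gu ht hu; apply: (hnf_linear (F := fun t => t ∣ u)) ht => //.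
- by move=> t1 t2 d; apply: d_bin d (derivable_ground_refl _).
- by apply: derivable_acp => //; apply: CM10.
- by move=> t1 t2 g1 g2; apply: derivable_acp => //; apply: CM8.
- move=> e; apply: (hnf_linear (F := fun u => act e ∣ u)) hu => //.
  + by move=> t1 t2 d; apply: d_bin (derivable_ground_refl _) d.
  + by apply: derivable_acp => //; apply: CM11.
  + by move=> t1 t2 g1 g2; apply: derivable_acp => //; apply: CM9.
  + move=> f; apply: hnf_derivable (hnf_const (gamma P (Some e) (Some f))) => //.
    by apply: derivable_acp => //; apply: CM12.
  + move=> f q gq; apply: hnf_derivable (hnf_const_prefix (gamma P (Some e) (Some f)) gq).
    by apply: derivable_acp => //; apply: CM6.
- move=> e p gp; apply: (hnf_linear (F := fun u => (act e * p) ∣ u)) hu => //.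
  + by move=> t1 t2 d; apply: d_bin (derivable_ground_refl _) d.
  + by apply: derivable_acp => //; apply: CM11.
  + by move=> t1 t2 g1 g2; apply: derivable_acp => //; apply: CM9.
  + move=> f; apply: hnf_derivable (hnf_const_prefix (gamma P (Some e) (Some f)) gp).
    by apply: derivable_acp => //; apply: CM5.
  + move=> f q gq.
    apply: hnf_derivable (hnf_const_prefix (gamma P (Some e) (Some f)) (p := p ∥ q) _) => //.
    by apply: derivable_acp => //; apply: CM7.
Qed.

Lemma hnf_par t u : ground t -> ground u ->
  has_hnf t -> has_hnf u -> has_hnf (t ∥ u).
Proof.
move=> gt gu ht hu; apply: hnf_derivable (derivable_acp _ _ (CM1 _ _ _)) _ => //.
by apply: hnf_alt (hnf_cmerge _ _ _ _) => //; apply: hnf_alt; apply: hnf_lmerge.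
Qed.

Lemma hnf_bin o t u : ground t -> ground u ->
  has_hnf t -> has_hnf u -> has_hnf (bin o t u).
Proof.
case: o => gt gu ht hu.
- exact: hnf_alt.
- exact: hnf_seqc.
- exact: hnf_par.
- exact: hnf_lmerge.
- exact: hnf_cmerge.
Qed.

(** By SI2 and SI8 the operator is linear in the selected argument; the other arguments end up below
    the first action, where groundness suffices. *)
Lemma hnf_posi n (i : 'I_n.+1) h s (x : 'I_n.+1 -> rterm) :
  (forall j, ground (x j)) -> has_hnf (x i) -> has_hnf (posi i h s x).
Proof.
move=> gx hx; rewrite -(replace_arg_id x i).
have gr t : ground t -> forall j, ground (replace_arg x i t j).
  exact: replace_arg_all.
have ga m (y : 'I_m -> rterm) d : (forall j, ground (y j)) ->
    forall j, ground (append_arg y (cr P d) j).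
  by move=> gy; apply: append_arg_all => //; apply: ground_cr.
have gd m (y : 'I_m.+1 -> rterm) k : (forall j, ground (y j)) ->
    forall j, ground (remove_arg y k j) by move=> gy j; apply: gy.
move: (x i) hx; apply: (hnf_linear (F := fun t => posi i h s (replace_arg x i t))).
- move=> t u tu; apply: d_posi => j; rewrite /replace_arg.
  by case: eqP => // _; apply: derivable_ground_refl.
- by apply: derivable_si (SI2 _ _ _ _ _) => //; exact: gr.
- move=> t u gt gu; apply: derivable_si; last exact: SI8.
  + exact: gr.
  + by split; apply: gr.
(* In SI6 the created process makes up for the terminated one, so arity 1 needs no separate
   treatment here. *)
- move=> e; case: (pselect (exists d, e = pcr P d)) => [[d ->]|oe].
    apply: hnf_derivable (derivable_si _ _ (SI6 _ _ _ _ _ _)) (hnf_prefix _ _) => /=.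
    + exact: gr.
    + by split=> //; apply/ga/gd.
    + by apply/ga/gd.
  have {}oe : ordinary P e by move=> d de; apply: oe; exists d.
  (* When the last process terminates nothing remains to interleave: SI3 for arity 1, SI4 for larger
     arities. *)
  case: n i x gx gr => [|n] i x gx gr.
    apply: hnf_derivable (hnf_act e); apply: derivable_si => //; first exact: gr.
    rewrite (_ : replace_arg x i (act e) = fun=> act e); first exact: SI3.
    by apply/funext => j; rewrite /replace_arg (ord1 i) (ord1 j).
  apply: hnf_derivable (derivable_si _ _ (SI4 _ _ _ _ oe)) (hnf_prefix _ _) => /=.
  + exact: gr.
  + by split=> //; apply/gd.
  + by apply/gd.
- move=> e y gy; case: (pselect (exists d, e = pcr P d)) => [[d ->]|oe].
    apply: hnf_derivable (derivable_si _ _ (SI7 _ _ _ _ _ _ _)) (hnf_prefix _ _) => /=.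
    + exact: gr.
    + by split=> //; apply/ga/gr.
    + by apply/ga/gr.
  have {}oe : ordinary P e by move=> d de; apply: oe; exists d.
  apply: hnf_derivable (derivable_si _ _ (SI5 _ _ _ _ _ oe)) (hnf_prefix _ _) => /=.
  + exact: gr.
  + by split=> //; apply/gr.
  + by apply/gr.
Qed.

Lemma hnf_inter n h s (x : 'I_n.+1 -> rterm) :
  (forall j, ground (x j)) -> (forall j, has_hnf (x j)) -> has_hnf (inter h s x).
Proof.
move=> gx hx; apply: hnf_derivable (hnf_posi _ _ gx (hx (sched P n h s))).
by apply: derivable_si => //; apply: SI1.
Qed.

(** Guardedness passes to every operand except the right one of a prefix, and a prefix is already a
    summand. The values of [s] thus stay below actions and need only be ground. *)
Lemma hnf_guarded (U : set V) (s : V -> rterm) (t : pterm) :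
  (forall X, U X -> ground (s X)) -> vars_in U t -> guarded t ->
  has_hnf (inst s t).
Proof.
move=> Us.
elim: t => //= [X _ gX|c _ _|o t IHt u IHu Ut gt|H t IH Ut gt
    |n h c ts IH Ut gt|n i h c ts IH Ut gt].
- by case: (gX X); apply: occ_var.
- exact: hnf_const.
- have Ut1 : vars_in U t by move=> Y g oc; apply: (Ut Y g); apply: occ_binl.
  have Ut2 : vars_in U u.
    by move=> Y g oc; apply: (Ut Y (g || prefixing o t)); apply: occ_binr.
  have g1 := ground_inst Ut1 Us; have g2 := ground_inst Ut2 Us.
  have ht : has_hnf (inst s t).
    by apply: IHt => // Y oc; apply: (gt Y); apply: occ_binl.
  (* To the right of a prefixing action variables may occur unguarded in [u], so the induction
     hypothesis for [u] is kept for the other case. *)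
  case pt: (prefixing o t).
    by case: o t pt ht g1 {IHt gt Ut Ut1} => //= -[] //= -[] // e _ _ _; apply: hnf_prefix.
  apply: hnf_bin => //; apply: IHu => // Y oc; apply: (gt Y).
  by rewrite -[false]/(false || false) -{2}pt; apply: occ_binr.
- apply: hnf_encap; apply: IH.
  + by move=> Y g oc; apply: (Ut Y g); apply: occ_encap.
  + by move=> Y oc; apply: (gt Y); apply: occ_encap.
- have Uts j : vars_in U (ts j).
    by move=> Y g oc; apply: (Ut Y g); apply: occ_inter; exact: oc.
  apply: hnf_inter => j; first exact: ground_inst (Uts j) Us.
  by apply: IH => // Y oc; apply: (gt Y); apply: occ_inter; exact: oc.
- have Uts j : vars_in U (ts j).
    by move=> Y g oc; apply: (Ut Y g); apply: occ_posi; exact: oc.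
  apply: hnf_posi => [j|]; first exact: ground_inst (Uts j) Us.
  by apply: IH => // Y oc; apply: (gt Y); apply: occ_posi; exact: oc.
Qed.

(** No circularity arises at a recursion constant: [hnf_guarded] asks only that the constants in its
    unfolded right-hand side be ground. *)
Lemma hnf_ground t : ground t -> has_hnf t.
Proof.
elim: t => //= [c _|o t IHt u IHu [gt gu]|H t IH gt|n h c ts IH gt|n i h c ts IH gt|[X E] dX].
- exact: hnf_const.
- by apply: hnf_bin; auto.
- by apply: hnf_encap; apply: IH.
- by apply: hnf_inter => // j; apply: IH.
- by apply: hnf_posi => //; apply: IH.
- have [t [Xt gt vt]] := recc_guarded dX.
  apply: hnf_derivable Xt _; apply: hnf_guarded vt gt => Y.
  by rewrite /recs /vars /=; case EY: (E Y) => [u|] // _; split; [exact: dX.1|rewrite /vars /= EY].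
Qed.

(** * Linear right-hand sides *)

Fixpoint number (K : Type) (v : nat -> V) (l : seq (A * option rterm)) :
    seq (A * option (term A S V K)) :=
  if l is m :: l' then
    (m.1, omap (fun=> var (v 0)) m.2) :: number K (fun k => v k.+1) l'
  else [::].

(** As in [number], summands without continuation also use up a position. There and past the end the
    value is [delta], so that every address names a ground term. *)
Definition continuation (l : seq (A * option rterm)) k : rterm :=
  if onth l k is Some (_, Some p) then p else delta.

Lemma ground_continuation l k :
  (forall m, List.In m l -> ground_summand m) -> ground (continuation l k).
Proof.
rewrite /continuation.
elim: l k => [|[e [p|]] l IH] [|k] H //=; try by apply: IH => m lm; apply: H; right.
exact: (H (e, Some p) (or_introl erefl)).
Qed.

Lemma inst_number (s : V -> rterm) v l :
  (forall k, s (v k) = continuation l k) -> inst s (sum (number void v l)) = sum l.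
Proof.
elim: l v => //= -[e p] l IH v H; rewrite IH => [|k]; last exact: (H k.+1).
by case: p H => [p|] //= H; rewrite (H 0).
Qed.

Lemma occ_bin_inv X o (t u : pterm) g :
  occ X (bin o t u) g ->
  occ X t g \/ exists2 g', occ X u g' & g = g' || prefixing o t.
Proof.
move E: (bin o t u) => w oc; case: oc E => // [o' t' u' g' oc|o' t' u' g' oc] [-> -> ->].
- by left.
- by right; exists g'.
Qed.

(** Yields both guardedness, as the flag is always [true], and the bound on the variables of a
    right-hand side. *)
Lemma occ_number v l X g :
  occ X (sum (number void v l)) g -> g = true /\ exists k, X = v k.
Proof.
elim: l v g => [|[e p] l IH] v g /=; first by inversion 1.
case/occ_bin_inv => [|[g' /IH [-> [k ->]] ->]]; last by split=> //; exists k.+1.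
case: p => [p|]; last by inversion 1.
case/occ_bin_inv => [|[g' + ->]]; first by inversion 1.
by rewrite orbT => oc; split=> //; exists 0; inversion oc.
Qed.

(** Such sums contain no strategic interleaving operator; with [Q] empty this makes them terms over
    ACP. *)
Lemma histories_number Q v l : histories_in Q (sum (number void v l)).
Proof. by elim: l v => //= -[e [p|]]. Qed.

End Derivations.

(** Variables serve as names of addresses: [g] encodes, [f] decodes where possible, and the root
    address gets the given variable. *)
Lemma infinite_enum (V : Type) (X : V) : infinite_set [set: V] ->
  exists g : seq nat -> V, exists f : V -> option (seq nat),
    [/\ pcancel g f, ocancel f g & g [::] = X].
Proof.
move=> /infiniteP/card_leP[h0].
pose h (a : seq nat) : V := \val (h0 (to_setT (choice.pickle a))).
have hI : injective h.
  move=> a b e; have := injT (val_inj e).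
  by move=> /(congr1 \val) /= /(pcan_inj choice.pickleK).
(* The injection [h] followed by the transposition of [h [::]] and [X]. *)
pose g a := if pselect (h a = X) then h [::]
            else if pselect (a = [::]) then X else h a.
have gI : injective g.
  move=> a b; rewrite /g.
  case: (pselect (h a = X)) => ha; case: (pselect (h b = X)) => hb /=.
  - by move=> _; apply: hI; rewrite ha.
  - case: pselect => b0 /= e; last by case: b0; apply: hI.
    by apply: hI; rewrite ha b0 e.
  - case: pselect => a0 /= e; last by case: a0; apply: hI.
    by apply: hI; rewrite hb a0 e.
  - case: (pselect (a = _)) => a0; case: (pselect (b = _)) => b0 /= e.
    + by rewrite a0 b0.
    + by case: hb.
    + by case: ha.
    + exact: hI.
pose f Y := if pselect (exists a, g a = Y) is left e then Some (sval (cid e)) else None.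
exists g, f; split.
- move=> a; rewrite /f; case: pselect => [e|[]]; last by exists a.
  by case: cid => b /= /gI ->.
- by move=> Y; rewrite /f; case: pselect => //= e; case: cid.
- by rewrite /g; case: pselect => // n; case: pselect.
Qed.

(** * The specification over ACP and its solution *)

Theorem theorem1 (A D S V : Type) (P : params A D S V)
  (Vinf : infinite_set [set: V])
  (gammaC : commutative (gamma P))
  (gammaA : associative (gamma P))
  (gamma_delta : forall a : option A, gamma P None a = None)
  (gamma_pcr : forall (d : D) (a : A), gamma P (Some (pcr P d)) (Some a) = None)
  (gamma_neq_pcr : forall (d : D) (a b : A),
     gamma P (Some a) (Some b) <> Some (pcr P d))
  (cr_ok : created_processes_ok P)
  (E : spec A S V) (X : V) :
  guarded_spec P siACP E -> vars E X ->
  exists E' : spec A S V,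
    [/\ guarded_spec P ACP E', vars E' X &
        derivable P (recc (X, E)) (recc (X, E'))].
Proof.
move=> gE EX; have [g [f [gK fK gX]]] := infinite_enum X Vinf.
(* A head normal form is fixed for every term at once; terms that are not ground get the empty
   list. *)
have /choice[hnf hnfP] : forall t : rterm A S V, exists l, ground P t ->
    (forall m, List.In m l -> ground_summand P m) /\ derivable P t (sum l).
  move=> t; case: (pselect (ground P t)) => [/(hnf_ground cr_ok)[l ? ?]|nt].
    by exists l.
  by exists [::].
(* Addresses grow at the head: [k :: a'] is continuation [k] of the term at [a'], and the root is
   the given constant. *)
pose node := fix node (a : seq nat) : rterm A S V :=
  if a is k :: a' then continuation (hnf (node a')) k else recc (X, E).
have node_ground a : ground P (node a).
  by elim: a => [|k a IH] //=; apply: ground_continuation; case: (hnfP _ IH).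
pose E' : spec A S V := fun Y =>
  omap (fun a => sum (number void (fun k => g (k :: a)) (hnf (node a)))) (f Y).
(* Both theories are needed: ACP for the conclusion, siACP because RSP is applied in the larger
   theory. *)
have E'_guarded T : guarded_spec P T E'.
  split.
    apply: (@sub_countable _ _ _ (range g)).
      apply: subset_card_le => Y; rewrite /vars /E' /=.
      by have := fK Y; case: (f Y) => //= a <- _; exists a.
    by apply: sub_countable (card_image_le _ _) _.
  move=> Y t; rewrite /E'; case: (f Y) => //= a [<-]; split.
    exact: histories_number.
  eexists; split; [exact: rw_refl|exact: histories_number|..].
  - by move=> Z oc; have [] := occ_number oc.
  - by move=> Z b oc; have [_ [k ->]] := occ_number oc; rewrite /vars /E' /= gK.
have E'X : vars E' X by rewrite /vars /E' /= -gX gK.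
exists E'; split=> //.
(* The solution handed to RSP; [delta] is a filler for variables that name no address. *)
pose s Y := if f Y is Some a then node a else delta.
have sg a : s (g a) = node a by rewrite /s gK.
rewrite -[recc (X, E)]/(node [::]) -sg gX; apply: d_RSP => // Y t.
rewrite {1}/E' /s; case: (f Y) => //= a [<-]; rewrite inst_number => [|k].
  (* Instantiated with [s], the right-hand side at [a] is the chosen head normal form of
     [node a]. *)
  by have [] := hnfP _ (node_ground a).
exact: sg.
Qed.
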